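(* Let $X$ be a measurable space, $Y$ a finite set, $c:X\times Y\to\mathbb{R}$ a measurable function, and $\Lambda\subset\mathbb{R}$ such that $$\bigcap_{\omega\in\Lambda}X_{A,\omega}\neq\emptyset\quad\text{for every }A\subset Y.$$ Then for every transport graph $G$ (over $Y$) there exists a pair of probability measures $(\mu,\nu)$, with $\mu$ on $X$ and $\nu$ on $Y$, such that $G=G_\omega$ for every $\omega\in\Lambda$, where $G_\omega$ is the $\omega$-transport graph defined using $(\mu,\nu)$.
   Context: $Y$ carries the $\sigma$-algebra of all its subsets and $X\times Y$ the product $\sigma$-algebra. For $A\subset Y$ and $\omega\in\mathbb{R}$, $$X_{A,\omega}:=\bigcap_{y\in A}\{x\in X: c(x,y)\le\omega\}\cap\bigcap_{y\in Y\setminus A}\{x\in X: c(x,y)>\omega\}.$$ A transport graph (over $Y$) is a bipartite graph with left vertex set $L=2^Y$ (all subsets of $Y$, including $\emptyset$), right vertex set $R=Y$, an unweighted edge between $A\in L$ and $y\in R$ if and only if $y\in A$, and non-negative vertex weights $w$ such that $\sum_{A\in L}w(A)=1$ and $\sum_{y\in R}w(y)=1$. Given probability measures $\mu$ on $X$ and $\nu$ on $Y$, the $\omega$-transport graph $G_\omega$ is the transport graph with weights $w(A)=\mu(X_{A,\omega})$ for $A\in 2^Y$ and $w(y)=\nu(\{y\})$ for $y\in Y$. Two transport graphs over $Y$ are equal when their vertex weights coincide. *)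

(* Defs.v *)
From HB Require Import structures.
From mathcomp Require Import all_boot all_order all_algebra.
From mathcomp Require Import all_classical all_reals all_analysis.
Set Implicit Arguments.
Unset Strict Implicit.
Unset Printing Implicit Defensive.
Import Order.TTheory GRing.Theory Num.Theory.
Import numFieldNormedType.Exports.

Local Open Scope classical_set_scope.
Local Open Scope ring_scope.

(* Like every measurableType, such a type is nonempty; there is no transport
   graph over the empty set, because its right weights would sum to 0. *)
#[short(type="finMeasurableType")]
HB.structure Definition FinMeasurable d := {T of Finite T & Measurable d T}.

Section transport_graph.
Variables (R : realType) (Y : finType).

Definition tg_vertex : Type := ({set Y} + Y)%type.

(* The edges depend on Y only, so they are not a field of transport_graph. *)
Definition tg_adj : rel tg_vertex := fun u v =>
  match u, v with
  | inl A, inr y | inr y, inl A => y \in A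
  | _, _ => false
  end.

Record transport_graph := TransportGraph {
  tg_weight :> tg_vertex -> R ;
  tg_weight_ge0 : forall v, 0 <= tg_weight v ;
  tg_weight_left : \sum_(A : {set Y}) tg_weight (inl A) = 1 ;
  tg_weight_right : \sum_(y : Y) tg_weight (inr y) = 1 }.

Lemma transport_graphP (G H : transport_graph) : G = H <-> G =1 H.
Proof.
split=> [->//|]; case: G H => [w p q r] [w' p' q' r'] /= /funext E.
move: p q r p' q' r'; rewrite E => *.
by congr TransportGraph; exact: Prop_irrelevance.
Qed.

End transport_graph.

Lemma probability_partition d (T : measurableType d) (R : realType)
    (P : probability T R) (I : finType) (F : I -> set T) :
    (forall i, measurable (F i)) -> trivIset setT F ->
    \bigcup_i F i = setT ->
  \sum_i fine (P (F i)) = 1.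
Proof.
move=> mF tF cF; apply: EFin_inj; rewrite -sumEFin -(probability_setT P) -cF.
rewrite measure_fin_bigcup//; last exact: finite_finset.
symmetry; rewrite (@fsbigE _ _ _ I _ (index_enum I)) ?index_enum_uniq//.
  apply: eq_big => [i|i _]; first by rewrite mem_set.
  by rewrite fineK ?fin_num_measure.
by move=> i _; rewrite mem_index_enum.
Qed.

Section omega_transport_graph.
Context d d' (X : measurableType d) (Y : finMeasurableType d') (R : realType).
Variable c : X * Y -> R.

(* The set of points x whose sublevel set {y | c (x, y) <= w} is exactly A. *)
Definition level_cell (A : {set Y}) (w : R) : set X :=
  \bigcap_(y in [set` A]) [set x | c (x, y) <= w] `&`
  \bigcap_(y in [set` ~: A]) [set x | c (x, y) > w].

Lemma level_cellP (A : {set Y}) (w : R) (x : X) :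
  level_cell A w x <-> A = [set y | c (x, y) <= w]%SET.
Proof.
split=> [[le gt]|->]; last first.
  by split=> y /=; rewrite !inE // -ltNge.
apply/setP => y; rewrite inE; case: (boolP (y \in A)) => yA.
  by rewrite (le y yA).
have /= := gt y; rewrite inE yA ltNge => /(_ isT).
by case: (c (x, y) <= w).
Qed.

Lemma trivIset_level_cell (w : R) : trivIset setT (level_cell ^~ w).
Proof. by move=> A B _ _ [x [/level_cellP -> /level_cellP ->]]. Qed.

Lemma bigcup_level_cell (w : R) : \bigcup_A level_cell A w = setT.
Proof.
apply/seteqP; split=> // x _.
by exists [set y | c (x, y) <= w]%SET => //; apply/level_cellP.
Qed.

Hypothesis Y_discrete : forall B : set Y, measurable B.
Hypothesis mc : measurable_fun setT c.

Lemma measurable_level_cell (A : {set Y}) (w : R) : measurable (level_cell A w).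
Proof.
have mcy y : measurable_fun setT (fun x => c (x, y)).
  by apply: (measurableT_comp mc); exact: pair2_measurable.
apply: measurableI; apply: fin_bigcap_measurable => // y _.
- rewrite (_ : [set x | _] = setT `&` (fun x => c (x, y)) @^-1` `]-oo, w]).
    exact: mcy.
  by rewrite setTI; apply/seteqP; split=> x /=; rewrite in_itv.
- rewrite (_ : [set x | _] = setT `&` (fun x => c (x, y)) @^-1` `]w, +oo[).
    exact: mcy.
  by rewrite setTI; apply/seteqP; split=> x /=; rewrite in_itv /= andbT.
Qed.

Variables (mu : probability X R) (nu : probability Y R).

Definition omega_weight (w : R) (v : tg_vertex Y) : R :=
  match v with
  | inl A => fine (mu (level_cell A w))
  | inr y => fine (nu [set y])
  end.

Lemma omega_weight_ge0 w v : 0 <= omega_weight w v.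
Proof. by case: v => [A|y]; apply: fine_ge0. Qed.

Lemma omega_weight_left w : \sum_(A : {set Y}) omega_weight w (inl A) = 1.
Proof.
apply: probability_partition.
- by move=> A; exact: measurable_level_cell.
- exact: trivIset_level_cell.
- exact: bigcup_level_cell.
Qed.

Lemma omega_weight_right w : \sum_(y : Y) omega_weight w (inr y) = 1.
Proof.
apply: probability_partition => //.
- by move=> y z _ _ [t [-> ->]].
- by apply/seteqP; split=> // y _; exists y.
Qed.

Definition omega_transport_graph (w : R) : transport_graph R Y :=
  TransportGraph (omega_weight_ge0 w) (omega_weight_left w)
    (omega_weight_right w).

End omega_transport_graph.

(* Main.v *)
(* Put mass w(A) at a point x_A lying in every cell X_{A,omega}, omega in
   Lambda: as the cells of a fixed omega partition X, the cell of A then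
   contains x_B exactly when B = A, so it has measure w(A).  The measure on Y
   puts mass w(y) at y. *)
From HB Require Import structures.
Require Import Defs.
From mathcomp Require Import all_boot all_order all_algebra.
From mathcomp Require Import all_classical all_reals all_analysis.
Import Order.TTheory GRing.Theory Num.Theory.
Import numFieldNormedType.Exports.

Local Open Scope classical_set_scope.
Local Open Scope ring_scope.

(** Induction on [s], each index adding a Dirac mass scaled by its weight. The formula holds for
    every set [A], measurable or not. *)
Lemma weighted_dirac_measure_exists {R : realType} {d} {T : measurableType d}
    {I : Type} (p : I -> R) (x : I -> T) (s : seq I) :
    (forall i, 0 <= p i) ->
  exists mu : {measure set T -> \bar R},
    forall A, mu A = (\sum_(i <- s) p i * \1_A (x i))%:E.
Proof.
move=> p_ge0; elim: s => [|i s [mu muE]].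
  by exists mzero => A; rewrite big_nil.
exists (measure_add (mscale (NngNum (p_ge0 i)) (dirac (x i))) mu) => A.
rewrite big_cons EFinD -muE.
exact: measure_addE.
Qed.

Lemma weighted_dirac_probability_exists {R : realType} {d}
    {T : measurableType d} {I : finType} (p : I -> R) (x : I -> T) :
    (forall i, 0 <= p i) -> \sum_i p i = 1 ->
  exists P : probability T R,
    forall A, P A = (\sum_i p i * \1_A (x i))%:E.
Proof.
move=> p_ge0 p_sum1.
have [mu muE] := weighted_dirac_measure_exists _ x (index_enum I) p_ge0.
(* The measure axioms are transported from the abstract [mu] to this explicit function, so that the
   resulting probability satisfies the required formula by computation. *)
pose m (A : set T) : \bar R := (\sum_i p i * \1_A (x i))%:E.
have mE : m = mu by apply/funext => A; rewrite muE.
have m0 : m set0 = 0%E by rewrite mE measure0.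
have m_ge0 A : (0 <= m A)%E by rewrite mE.
have m_additive : semi_sigma_additive m.
  by rewrite mE; exact: measure_semi_sigma_additive.
have m1 : m setT = 1%E.
  by rewrite /m -p_sum1; congr EFin; apply: eq_bigr => i _; rewrite indicT mulr1.
pose m_measure := isMeasure.Build d T R m m0 m_ge0 m_additive.
pose M : {measure set T -> \bar R} := HB.pack m m_measure.
pose M_probability := Measure_isProbability.Build d T R M m1.
pose P : probability T R := HB.pack m m_measure M_probability.
by exists P.
Qed.

(** Evaluates a weighted sum of Dirac masses on a set that catches the point of one index only; it
    serves for the cells in [X] and for the singletons in [Y]. *)
Lemma sum_mul_indic_single {R : realType} {T : Type} {I : finType}
    (p : I -> R) (x : I -> T) (A : set T) (i : I) :
    (forall j, A (x j) <-> j = i) ->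
  \sum_j p j * \1_A (x j) = p i.
Proof.
move=> Ax; rewrite (bigD1 i)//= big1 => [|j /eqP ji].
  by rewrite addr0 indicE mem_set ?mulr1//; apply/Ax.
by rewrite indicE memNset ?mulr0// => /Ax.
Qed.

Theorem proposition3p1 (R : realType)
    (d d' : measure_display)
    (X : measurableType d) (Y : finMeasurableType d')
    (Y_discrete : forall B : set Y, measurable B)
    (c : X * Y -> R) (mc : measurable_fun setT c)
    (Lambda : set R)
    (hLambda : forall A : {set Y},
       \bigcap_(w in Lambda) level_cell c A w !=set0)
    (G : transport_graph R Y) :
  exists (mu : probability X R) (nu : probability Y R),
    forall w : R, Lambda w ->
      G = omega_transport_graph Y_discrete mc mu nu w.
Proof.
have [x xP] := choice hLambda.
have [mu muE] := weighted_dirac_probability_exists _ x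
  (fun A => tg_weight_ge0 G (inl A)) (tg_weight_left G).
have [nu nuE] := weighted_dirac_probability_exists _ id
  (fun y => tg_weight_ge0 G (inr y)) (tg_weight_right G).
exists mu, nu => w Lw; apply/transport_graphP => -[A|y] /=.
- rewrite muE /= (sum_mul_indic_single _ _ _ A)// => B.
  (* The sublevel set of [x B] at [w] is [B], because [x B] lies in the cell of [B]; membership of
     [x B] in the cell of [A] thus reduces to [A = B]. *)
  by rewrite level_cellP; have /level_cellP <- := xP B w Lw; split.
- by rewrite nuE /= (sum_mul_indic_single _ _ _ y).
Qed.
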